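(* Let $\mathcal{F}$ be an annotated signature. Suppose that for each constructor $c$ and each declaration $A_1^{\vec u_1}\times\cdots\times A_n^{\vec u_n}\xrightarrow{p}C^{\vec w}\in\mathcal{F}(c)$ with $\mathrm{len}(\vec w)\geqslant 1$, there exist resource annotations $\vec r_1,\dots,\vec r_n$ such that $\vec u_i\leqslant\vec w+\vec r_i$, $\max\vec r_i\leqslant\max\vec w=:r$, $p\leqslant r$ and $\mathrm{len}(\vec r_i)<\mathrm{len}(\vec w)=:k$. Then for every value $v$ of base type $C$ and every annotation $\vec w$, $\Phi(v:C^{\vec w})\leqslant r\,|v|^{k}$, where $r=\max\vec w$ and $k=\mathrm{len}(\vec w)$.
   Context: $\mathcal{C}$ is a finite set of constructor symbols, $S$ a finite set of base types; each constructor has a base type declaration $A_1\times\cdots\times A_n\to C$. Values are ground terms built from constructors, respecting declarations; $|v|$ denotes the number of symbols of $v$. A resource annotation is a finite vector $\vec p=(p_1,\dots,p_k)$ of non-negative rationals, $\mathrm{len}(\vec p)=k$, $\max\vec p=\max_ip_i$ (with $\max()=0$); $\leqslant$ and $+$ on annotations are componentwise after padding the shorter vector with zeros. An annotated type $A^{\vec p}$ is a base type with an annotation. An annotated signature $\mathcal{F}$ maps each constructor $c$ with base declaration $A_1\times\cdots\times A_n\to C$ to a nonempty set of annotated declarations $A_1^{\vec u_1}\times\cdots\times A_n^{\vec u_n}\xrightarrow{p}C^{\vec w}$ ($p\geqslant0$) such that for each annotation $\vec w$ there is exactly one declaration with result $C^{\vec w}$, and $\mathcal{F}(c)$ is closed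 under multiplying all annotations and the cost by any $\lambda\geqslant0$ and under componentwise addition of two declarations. The potential of a value $v=c(v_1,\dots,v_n)$ at annotated type $C$ is $\Phi(v:C)=p+\sum_i\Phi(v_i:A_i)$, where $A_1\times\cdots\times A_n\xrightarrow{p}C$ is the unique declaration of $c$ with result $C$. *)

(* Defs.v *)
From HB Require Import structures.
From mathcomp Require Import all_boot all_order all_algebra.
From mathcomp Require Import boolp classical_sets.

Set Implicit Arguments.
Unset Strict Implicit.
Unset Printing Implicit Defensive.

Import Order.TTheory GRing.Theory Num.Theory.

Local Open Scope classical_set_scope.
Local Open Scope ring_scope.

Record base_signature := BaseSignature {
  base : finType;
  constr : finType;
  dom : constr -> seq base;
  cod : constr -> base
}.

Definition arity (B : base_signature) (c : constr B) : nat := size (dom c).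

Definition argtype (B : base_signature) (c : constr B) (i : 'I_(arity c)) :
  base B := tnth (in_tuple (dom c)) i.

(* Intrinsically typed ground terms: [value A] is the type of the values of
   base type [A]. *)
Inductive value (B : base_signature) : base B -> Type :=
| Con (c : constr B) :
    (forall i : 'I_(arity c), value (argtype i)) -> value (cod c).

Fixpoint vsize (B : base_signature) (A : base B) (v : value A) : nat :=
  match v with
  | Con c vs => (\sum_(i < arity c) vsize (vs i))%N.+1
  end.

(* Vectors of different lengths are different annotations, even when they only
   differ by trailing zeros. *)
Record annot := Annot {
  avec :> seq rat;
  avec_ge0 : all (fun q => 0 <= q) avec
}.

Definition alen (w : annot) : nat := size w.

Definition amax (w : annot) : rat := \big[Num.max/0]_(q <- avec w) q.

(* The default value 0 of [nth] does the padding. *)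
Definition ale (u w : annot) : Prop :=
  forall i : nat, (avec u)`_i <= (avec w)`_i.

Lemma annot_nth_ge0 (w : annot) (i : nat) : 0 <= (avec w)`_i.
Proof.
case: (ltnP i (size w)) => [lt_i|le_i]; last by rewrite nth_default.
exact: (allP (avec_ge0 w)) (mem_nth 0 lt_i).
Qed.

Lemma aadd_subproof (u w : annot) :
  all (fun q => 0 <= q)
    (mkseq (fun i => (avec u)`_i + (avec w)`_i) (maxn (size u) (size w))).
Proof.
by apply/allP => _ /mapP[i _ ->]; rewrite addr_ge0 ?annot_nth_ge0.
Qed.

Definition aadd (u w : annot) : annot := Annot (aadd_subproof u w).

Lemma ascale_subproof (l : rat) (l_ge0 : 0 <= l) (w : annot) :
  all (fun q => 0 <= q) [seq l * q | q <- avec w].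
Proof.
apply/allP => _ /mapP[q q_in ->]; rewrite mulr_ge0 //.
exact: (allP (avec_ge0 w)).
Qed.

Definition ascale (l : rat) (l_ge0 : 0 <= l) (w : annot) : annot :=
  Annot (ascale_subproof l_ge0 w).

(* Annotated declarations of [c]; the base types are those of the base
   declaration of [c], so only the annotations and the cost are recorded. *)
Record decl (B : base_signature) (c : constr B) := Decl {
  dargs : (arity c).-tuple annot;
  dcost : rat;
  dres : annot;
  dcost_ge0 : 0 <= dcost
}.

Definition dscale (B : base_signature) (c : constr B) (l : rat)
    (l_ge0 : 0 <= l) (d : decl c) : decl c :=
  @Decl B c [tuple ascale l_ge0 (tnth (dargs d) i) | i < arity c]
    (l * dcost d) (ascale l_ge0 (dres d)) (mulr_ge0 l_ge0 (dcost_ge0 d)).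

Definition dadd (B : base_signature) (c : constr B) (d e : decl c) : decl c :=
  @Decl B c [tuple aadd (tnth (dargs d) i) (tnth (dargs e) i) | i < arity c]
    (dcost d + dcost e) (aadd (dres d) (dres e))
    (addr_ge0 (dcost_ge0 d) (dcost_ge0 e)).

Unset Implicit Arguments.

Record annotated_signature (B : base_signature) := AnnotatedSignature {
  decls :> forall c : constr B, set (decl c);
  decls_nonempty : forall c : constr B, decls c !=set0;
  decls_unique : forall (c : constr B) (w : annot),
    exists! d : decl c, decls c d /\ dres d = w;
  decls_scale : forall (c : constr B) (l : rat) (l_ge0 : 0 <= l) (d : decl c),
    decls c d -> decls c (dscale l_ge0 d);
  decls_add : forall (c : constr B) (d e : decl c),
    decls c d -> decls c e -> decls c (dadd d e)
}.

Set Implicit Arguments.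

Definition decl_of (B : base_signature) (F : annotated_signature B)
    (c : constr B) (w : annot) : decl c :=
  sval (cid (decls_unique B F c w)).

Lemma decl_ofP (B : base_signature) (F : annotated_signature B)
    (c : constr B) (w : annot) :
  F c (decl_of F c w) /\ dres (decl_of F c w) = w.
Proof. by have [] := svalP (cid (decls_unique B F c w)). Qed.

Lemma decl_of_unique (B : base_signature) (F : annotated_signature B)
    (c : constr B) (w : annot) (d : decl c) :
  F c d -> dres d = w -> decl_of F c w = d.
Proof.
move=> Fd dw; have [_ uniq_d] := svalP (cid (decls_unique B F c w)).
exact: uniq_d.
Qed.

(* [potential F v w] is the potential of [v] at the type [A] annotated by
   [w]. *)
Fixpoint potential (B : base_signature) (F : annotated_signature B)
    (A : base B) (v : value A) (w : annot) : rat :=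
  match v with
  | Con c vs =>
      dcost (decl_of F c w) +
      \sum_(i < arity c) potential F (vs i) (tnth (dargs (decl_of F c w)) i)
  end.

(* Main.v *)
(** Uniqueness of declarations together with closure under scaling and addition
    makes [potential F v] linear in the annotation; since potentials are
    nonnegative it is therefore monotone, and annotations that differ only by
    trailing zeros have the same potential.  The bound then follows by induction
    on the value, from [1 + \sum_i (n_i ^ k + n_i ^ k.-1) <= (1 + \sum_i n_i) ^ k]
    for [k >= 2]; for [k = 1] the annotations [r_i] are empty and contribute
    nothing. *)
Require Import Defs.
From HB Require Import structures.
From mathcomp Require Import all_boot all_order all_algebra.
From mathcomp Require Import boolp classical_sets.

Import Order.TTheory GRing.Theory Num.Theory.

Local Open Scope ring_scope.

Lemma annot_inj : injective avec.
Proof.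
move=> [u pu] [w pw] /= euw; case: w / euw pw => pw.
by congr Annot; exact: eq_irrelevance.
Qed.

Lemma amax_ge0 (w : annot) : 0 <= amax w.
Proof. by rewrite /amax; elim/big_rec: _ => // i x _ x0; rewrite le_max x0 orbT. Qed.

Lemma amax_nil (w : annot) : alen w = 0%N -> amax w = 0.
Proof. by rewrite /amax /alen => /size0nil ->; rewrite big_nil. Qed.

Lemma nth_aadd (u w : annot) (i : nat) :
  (avec (aadd u w))`_i = (avec u)`_i + (avec w)`_i.
Proof.
rewrite /=; case: (ltnP i (maxn (size u) (size w))) => [?|le_i].
  by rewrite nth_mkseq.
by move: (le_i); rewrite geq_max => /andP[? ?]; rewrite !nth_default ?size_mkseq ?addr0.
Qed.

(** Truncation at zero makes the difference an annotation for any two vectors; it is exact as soon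
    as [ale u w]. *)
Lemma asub_subproof (w u : annot) :
  all (fun q => 0 <= q)
    (mkseq (fun i => Num.max 0 ((avec w)`_i - (avec u)`_i))
       (maxn (size u) (size w))).
Proof. by apply/allP => _ /mapP[i _ ->]; rewrite le_max lexx. Qed.

Definition asub (w u : annot) : annot := Annot (asub_subproof w u).

Lemma azero_subproof (k : nat) : all (fun q : rat => 0 <= q) (nseq k 0).
Proof. by rewrite all_nseq lexx orbT. Qed.

Definition azero (k : nat) : annot := Annot (azero_subproof k).

(** Presents [azero k] as a multiple by zero, so that homogeneity makes its potential vanish. *)
Lemma ascale0 (k : nat) : ascale (lexx (0 : rat)) (azero k) = azero k.
Proof. by apply: annot_inj; rewrite /= map_nseq mul0r. Qed.

(* Padding [w] with zeros makes the two sides equal as vectors, lengths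
   included. *)
Lemma aadd_asub (u w : annot) :
  ale u w -> aadd u (asub w u) = aadd w (azero (size u)).
Proof.
move=> le_uw; apply: annot_inj; apply: (@eq_from_nth _ 0).
  by rewrite /= !size_mkseq size_nseq maxnA maxnn maxnC.
move=> i; rewrite size_mkseq /= size_mkseq maxnA maxnn => lt_i.
have := nth_aadd w (azero (size u)) i; rewrite /= => ->.
rewrite nth_mkseq ?size_mkseq ?maxnA ?maxnn // nth_mkseq //.
by rewrite nth_nseq if_same addr0 max_r ?subr_ge0 ?le_uw // addrC subrK.
Qed.

Lemma potential_ge0 (B : base_signature) (F : annotated_signature B)
    (C : base B) (v : value C) (w : annot) : 0 <= potential F v w.
Proof.
elim: v w => c vs IH w /=; rewrite addr_ge0 ?dcost_ge0 //.
by apply: sumr_ge0 => i _; exact: IH.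
Qed.

(** The scaled declaration lies in [F c] and has the scaled result, so by uniqueness it is the one
    that [decl_of] selects. *)
Lemma potential_scale (B : base_signature) (F : annotated_signature B)
    (C : base B) (v : value C) (l : rat) (l_ge0 : 0 <= l) (w : annot) :
  potential F v (ascale l_ge0 w) = l * potential F v w.
Proof.
elim: v w => c vs IH w /=; have [Fd dw] := decl_ofP F c w.
rewrite (decl_of_unique (d := dscale l_ge0 (decl_of F c w))) /= ?dw //; last first.
  exact: decls_scale.
rewrite mulrDr mulr_sumr; congr (_ + _); apply: eq_bigr => i _.
by rewrite tnth_mktuple IH.
Qed.

Lemma potential_add (B : base_signature) (F : annotated_signature B)
    (C : base B) (v : value C) (u w : annot) :
  potential F v (aadd u w) = potential F v u + potential F v w.
Proof.
elim: v u w => c vs IH u w /=.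
have [Fd du] := decl_ofP F c u; have [Fe dw] := decl_ofP F c w.
rewrite (decl_of_unique (d := dadd (decl_of F c u) (decl_of F c w))) /= ?du ?dw //;
  last exact: decls_add.
rewrite addrACA -big_split /=; congr (_ + _); apply: eq_bigr => i _.
by rewrite tnth_mktuple IH.
Qed.

Lemma potential_azero (B : base_signature) (F : annotated_signature B)
    (C : base B) (v : value C) (k : nat) : potential F v (azero k) = 0.
Proof. by rewrite -ascale0 potential_scale mul0r. Qed.

Lemma potential_le (B : base_signature) (F : annotated_signature B)
    (C : base B) (v : value C) (u w : annot) :
  ale u w -> potential F v u <= potential F v w.
Proof.
(* The zero padding contributes nothing, and the difference contributes a nonnegative potential. *)
move=> /aadd_asub /(congr1 (potential F v)).
by rewrite !potential_add potential_azero addr0 => <-; rewrite lerDl potential_ge0.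
Qed.

Lemma vsize_gt0 (B : base_signature) (C : base B) (v : value C) : (0 < vsize v)%N.
Proof. by case: v. Qed.

(** Split off one factor of the right-hand power and distribute it: each [f i] then multiplies a
    power of the sum, which dominates the same power of [f i]. *)
Lemma leq_sum_expS (n : nat) (f : 'I_n -> nat) (k : nat) :
  (\sum_i f i ^ k.+1 <= (\sum_i f i) ^ k.+1)%N.
Proof.
rewrite expnS big_distrl /=; apply: leq_sum => i _; rewrite expnS leq_mul2l.
case: k => [|k]; first by rewrite orbT.
by rewrite leq_exp2r // (bigD1 i) //= leq_addr orbT.
Qed.

Lemma leq_expS_add1 (n k : nat) : (n ^ k.+1 + 1 <= n.+1 ^ k.+1)%N.
Proof. by rewrite addn1 ltn_exp2r. Qed.

Lemma leq_sum_exp_succ (n : nat) (f : 'I_n -> nat) (k : nat) :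
  (1 + \sum_i (f i ^ k.+2 + f i ^ k.+1) <= (\sum_i f i).+1 ^ k.+2)%N.
Proof.
rewrite big_split /=; set N := (\sum_i f i)%N.
(* With N the sum, the right side is at least (N+1)(N^(k+1) + 1) = N^(k+2) + N^(k+1) + N + 1. *)
have step : (1 + (N ^ k.+2 + N ^ k.+1) <= N.+1 ^ k.+2)%N.
  rewrite [(N.+1 ^ _)%N]expnS.
  apply: leq_trans (leq_mul (leqnn N.+1) (leq_expS_add1 N k)).
  by rewrite mulnDr muln1 mulSn -expnS [(N ^ k.+1 + _)%N]addnC addnC leq_add2l.
by apply: leq_trans step; rewrite leq_add2l leq_add ?leq_sum_expS.
Qed.

Theorem theorem2 (B : base_signature) (F : annotated_signature B)
  (hF : forall (c : constr B) (d : decl c), F c d ->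
     (1 <= alen (dres d))%N ->
     exists r : (arity c).-tuple annot,
       dcost d <= amax (dres d) /\
       forall i : 'I_(arity c),
         [/\ ale (tnth (dargs d) i) (aadd (dres d) (tnth r i)),
             amax (tnth r i) <= amax (dres d)
           & (alen (tnth r i) < alen (dres d))%N])
  (C : base B) (v : value C) (w : annot) :
  potential F v w <= amax w * (vsize v)%:R ^+ alen w.
Proof.
elim: v w => c vs IH w.
case kE: (alen w) => [|k].
  (* In length zero [hF] gives nothing, but the annotation is empty and both sides vanish. *)
  have -> : w = azero 0 by apply: annot_inj; move/size0nil: kE.
  by rewrite potential_azero mulr_ge0 ?amax_ge0 ?exprn_ge0 ?ler0n.
rewrite [potential F _ w]/= [vsize _]/=.
have [Fd dw] := decl_ofP F c w.
have := hF c (decl_of F c w) Fd; rewrite dw kE => /(_ isT) [r [le_p le_r]].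
set n := fun i => vsize (vs i).
(* Monotonicity and additivity split the argument's potential into those at [w] and at [r_i]; the
   induction hypothesis bounds each. *)
have arg_le i : potential F (vs i) (tnth (dargs (decl_of F c w)) i) <=
    amax w * (n i)%:R ^+ k.+1 + amax (tnth r i) * (n i)%:R ^+ alen (tnth r i).
  have [le_u _ _] := le_r i; apply: le_trans (potential_le _ F _ (vs i) _ _ le_u) _.
  by rewrite potential_add lerD ?IH // -kE IH.
apply: le_trans (lerD le_p (ler_sum _ (fun i _ => arg_le i))) _.
case: k => [|k] in kE le_r arg_le *.
  have r0 i : amax (tnth r i) = 0.
    by have [_ _] := le_r i; rewrite ltnS leqn0 => /eqP/amax_nil.
  under [X in _ + X <= _]eq_bigr => i _ do rewrite r0 mul0r addr0 expr1.
  by rewrite -mulr_sumr expr1 -natr_sum -[X in X + _]mulr1 -mulrDr nat1r.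
(* Raising the exponent from the length of [r_i] to [k.+1] relies on [n i] being at least 1. *)
have low_le i : amax (tnth r i) * (n i)%:R ^+ alen (tnth r i)
    <= amax w * (n i)%:R ^+ k.+1.
  have [_ le_m lt_k] := le_r i.
  by rewrite ler_pM ?amax_ge0 ?exprn_ge0 ?ler0n // ler_weXn2l ?ler1n ?vsize_gt0.
apply: le_trans (lerD (lexx _) (ler_sum _ (fun i _ => lerD (lexx _) (low_le i)))) _.
under [X in _ + X <= _]eq_bigr => i _ do rewrite -mulrDr -!natrX -natrD.
rewrite -mulr_sumr -[X in X + _]mulr1 -mulrDr -natr_sum -natrX nat1r.
by rewrite ler_wpM2l ?amax_ge0 // ler_nat -add1n leq_sum_exp_succ.
Qed.
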